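(* Let $s\ge1$ be an integer and let $G_n^{4,s}$ be the graph obtained by taking $n$ disjoint copies of the complete graph $K_s$, choosing one vertex $v_i$ in the $i$-th copy, adding $n$ new vertices $w_1,\dots,w_n$ with edges $w_iv_i$ ($i=1,\dots,n$), and adding edges $v_iv_{i+1}$ ($i=1,\dots,n-1$). Let $f(m)$ be the number of maximal matchings of $K_m$, i.e. $f(m)=m!!$ for $m$ odd and $f(m)=(m-1)!!$ for $m$ even ($f(0)=1$), with the convention that $(s-1)f(s-2)=0$ when $s=1$. Then $$\lim_{n\to\infty}\mathcal{I}(G_n^{4,s})=\frac{r\Big(\lfloor\frac{s+1}{2}\rfloor f(s-1)+\lceil\frac{s-1}{2}\rceil(s-1)f(s-2)\Big)+\big(2\lfloor\frac{s-1}{2}\rfloor+1\big)f(s-1)^2}{\lceil\frac{s}{2}\rceil\Big(r\big(f(s-1)+(s-1)f(s-2)\big)+2f(s-1)^2\Big)},$$ where $r=\frac12\Big(f(s-1)+(s-1)f(s-2)+\sqrt{5f(s-1)^2+2(s-1)f(s-1)f(s-2)+(s-1)^2f(s-2)^2}\Big)$.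
   Context: For a finite simple graph $G$: a matching is a set of pairwise vertex-disjoint edges; it is maximal if not contained in a larger matching. $\nu(G)$ is the maximum matching size, $\mathcal{T}_0(G)$ the number of maximal matchings, $\mathcal{T}_1(G)$ the sum of the sizes of all maximal matchings, and $\mathcal{I}(G)=\frac{\mathcal{T}_1(G)}{\nu(G)\mathcal{T}_0(G)}$ (equal to $1$ by convention if $\nu(G)=0$). For odd $m$, $m!!=\prod_{k=0}^{(m-1)/2}(m-2k)$. *)

(* Defs.v *)
From HB Require Import structures.
From mathcomp Require Import all_boot all_order all_algebra.
From mathcomp Require Import all_classical all_reals all_analysis.

Set Implicit Arguments.
Unset Strict Implicit.
Unset Printing Implicit Defensive.

Import Order.TTheory GRing.Theory Num.Theory.

Record sgraph := SGraph {
  vertex :> finType;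
  adj : rel vertex;
  adj_sym : symmetric adj;
  adj_irrefl : irreflexive adj }.

Definition edges (G : sgraph) : {set {set G}} :=
  [set e : {set G} |
    [exists x : G, exists y : G, adj x y && (e == [set x; y]%SET)]].

Definition matching (G : sgraph) (M : {set {set G}}) : bool :=
  (M \subset edges G) && finset.trivIset M.

Definition maximal_matching (G : sgraph) (M : {set {set G}}) : bool :=
  maxset (@matching G) M.

Definition nu (G : sgraph) : nat := \max_(M | @matching G M) #|M|.

Definition T0 (G : sgraph) : nat := #|[set M | @maximal_matching G M]%SET|.

Definition T1 (G : sgraph) : nat := \sum_(M | @maximal_matching G M) #|M|.

Definition Iratio (R : realType) (G : sgraph) : R :=
  if nu G == 0 then 1%R else ((T1 G)%:R / ((nu G)%:R * (T0 G)%:R))%R.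

(* The double factorial; only meant for odd m, where the last index is
   (m - 1) / 2 = (m + 1) / 2 - 1. *)
Definition dfact (m : nat) : nat := \prod_(k < m.+1./2) (m - 2 * k).

Section Complete.
Variable m : nat.
Definition Kadj : rel 'I_m := fun x y => x != y.
Fact Kadj_sym : symmetric Kadj.
Proof. by move=> x y; rewrite /Kadj eq_sym. Qed.
Fact Kadj_irrefl : irreflexive Kadj.
Proof. by move=> x; rewrite /Kadj eqxx. Qed.
Definition complete_graph : sgraph := SGraph Kadj_sym Kadj_irrefl.
End Complete.

Definition f (m : nat) : nat := T0 (complete_graph m).

(* inl (i, x) is the vertex x of the i-th copy of K_s and inr i is w_i; the
   chosen vertex v_i of the i-th copy is inl (i, c i). *)
Section G4.
Variables (s n : nat) (c : 'I_n -> 'I_s).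
Definition G4vertex : finType := (('I_n * 'I_s) + 'I_n)%type.
Definition G4adj : rel G4vertex := fun p q =>
  match p, q with
  | inl (i, x), inl (j, y) =>
      (i == j) && Kadj x y
      || [&& x == c i, y == c j & (j == i.+1 :> nat) || (i == j.+1 :> nat)]
  | inl (i, x), inr j => (i == j) && (x == c i)
  | inr i, inl (j, y) => (i == j) && (y == c j)
  | inr _, inr _ => false
  end.
Fact G4adj_sym : symmetric G4adj.
Proof.
move=> [[i x]|i] [[j y]|j] //=; last 2 first.
- by rewrite eq_sym; case: eqP => // ->.
- by rewrite eq_sym; case: eqP => // ->.
by rewrite (eq_sym j i) Kadj_sym andbCA (orbC (j == i.+1 :> nat)).
Qed.
Fact G4adj_irrefl : irreflexive G4adj.
Proof.
move=> [[i x]|i] //=.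
by rewrite Kadj_irrefl andbF /= ltn_eqF // !andbF.
Qed.
Definition G4 : sgraph := SGraph G4adj_sym G4adj_irrefl.
End G4.

(* Main.v *)
Require Import Defs.
From HB Require Import structures.
From mathcomp Require Import all_boot all_order all_algebra.
From mathcomp Require Import zify ring lra.

Set Implicit Arguments.
Unset Strict Implicit.
Unset Printing Implicit Defensive.

Import Order.TTheory GRing.Theory Num.Theory.

(** For a set [S] of vertices let [mmpoly S] be the sum of ['X^#|M|] over the
    maximal matchings [M] of the subgraph induced by [S].  A maximal matching
    of [S] containing an edge [e] is [e] together with a maximal matching of
    [S :\: e], so a vertex that every maximal matching covers can be expanded
    along its neighbours.  Expanding the last [v_i] (always covered, thanks to
    the pendant [w_i]) leaves isolated cliques, whose maximal matchings are
    counted by double factorials, and gives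
    [P_(n+2) = (a X^p + b X^q) P_(n+1) + a^2 X^u P_n]
    for the polynomial [P_n] of [G_n^{4,s}].  Its degree is [nu], and [T0], [T1]
    are [P_n] and its derivative at [1].  With [r], [q] the roots of
    [x^2 = (a + b) x + a^2], the derivative equals
    [n L P_n(1) + beta (r^n - q^n) + delta n q^n], and [|q| < r] leaves the
    limit [L]. *)

(** * Double factorials and the clique recursion *)

Definition card_mmK (m : nat) : nat := dfact (if odd m then m else m.-1).

Lemma dfactSS m : dfact m.+2 = m.+2 * dfact m.
Proof.
rewrite /dfact /= big_ord_recl muln0 subn0; congr (_ * _).
by apply: eq_bigr => i _; rewrite lift0 mulnS -[m.+2]/(2 + m) subnDl.
Qed.

Lemma card_mmK0 : card_mmK 0 = 1.
Proof. by rewrite /card_mmK /dfact big_ord0. Qed.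

Lemma card_mmK1 : card_mmK 1 = 1.
Proof. by rewrite /card_mmK /dfact big_ord_recl big_ord0. Qed.

(** This is the count that expanding one vertex of $K_{m+2}$ produces: it has $m+1$ possible
    partners, each leaving $K_m$, or it stays uncovered, which needs the other $m+1$ vertices to be
    perfectly matched, hence $m$ odd. *)
Lemma card_mmKSS m :
  card_mmK m.+2 = m.+1 * card_mmK m + odd m * card_mmK m.+1.
Proof.
rewrite /card_mmK /= negbK; case: ifP => om /=.
  by rewrite dfactSS mul1n -mulSnr.
(* For even [m] the right side contains [dfact m.-1]; at [m = 0] this is an empty product, outside
   the reach of [dfactSS]. *)
rewrite mul0n addn0; case: m om => [|m] _; last by rewrite dfactSS.
by rewrite /dfact /= big_ord_recl !big_ord0.
Qed.

Lemma card_mmK_gt0 m : 0 < card_mmK m.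
Proof.
elim/ltn_ind: m => -[|[|m]] IH; rewrite ?card_mmK0 ?card_mmK1 //.
by rewrite card_mmKSS ltn_addr // muln_gt0 /= IH.
Qed.

(** * Maximal matchings of induced subgraphs *)

Section MaximalMatchings.
Variables (R : comNzRingType) (G : sgraph).
Implicit Types (S C A e : {set G}) (M : {set {set G}}) (x y u v : G).

Lemma edgesP e :
  reflect (exists x y, adj x y /\ e = [set x; y]) (e \in edges G).
Proof.
rewrite inE; apply: (iffP existsP) => [[x /existsP[y /andP[xy /eqP ->]]]|].
  by exists x, y.
by case=> x [y [xy ->]]; exists x; apply/existsP; exists y; rewrite xy eqxx.
Qed.

Lemma adj_neq x y : adj x y -> x != y.
Proof. by apply: contraTneq => ->; rewrite adj_irrefl. Qed.

Lemma edge_adj x y : adj x y -> [set x; y] \in edges G.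
Proof. by move=> xy; apply/edgesP; exists x, y. Qed.

Lemma edge_at e v : e \in edges G -> v \in e ->
  exists2 u, adj v u & e = [set v; u].
Proof.
move=> /edgesP[x [y [xy ->]]]; rewrite !inE => /orP[] /eqP ->; first by exists y.
by exists x; rewrite 1?adj_sym // setUC.
Qed.

Lemma edge_set2 x y : [set x; y] \in edges G -> adj x y.
Proof.
move=> /edge_at /(_ (set21 x y))[u xu E].
have : u \in [set x; y] by rewrite E set22.
have := adj_neq xu; rewrite !inE eq_sym => /negPf -> /= /eqP <- //.
Qed.

Lemma card_edge e : e \in edges G -> #|e| = 2.
Proof. by move=> /edgesP[x [y [/adj_neq xy ->]]]; rewrite cards2 xy. Qed.

(* Maximal matchings of the subgraph induced by [S]. *)
Definition mm S M :=
  [&& M \subset edges G, trivIset M, cover M \subset S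
    & [forall x in S, forall y in S,
        adj x y ==> (x \in cover M) || (y \in cover M)]].

Lemma mmP S M : reflect
  [/\ M \subset edges G, trivIset M, cover M \subset S
    & {in S &, forall x y, adj x y -> (x \in cover M) || (y \in cover M)}]
  (mm S M).
Proof.
apply: (iffP and4P) => -[ME tM cM H]; split=> //.
  move=> x y xS yS xy.
  by move/forall_inP: H => /(_ x xS)/forall_inP/(_ y yS)/implyP/(_ xy).
apply/forall_inP => x xS; apply/forall_inP => y yS; apply/implyP; exact: H.
Qed.

Lemma mem_cover M e x : e \in M -> x \in e -> x \in cover M.
Proof. by move=> eM xe; apply/bigcupP; exists e. Qed.

Lemma trivIset_eq M e e' x :
  trivIset M -> e \in M -> e' \in M -> x \in e -> x \in e' -> e = e'.
Proof.
move=> /trivIsetP tM eM e'M xe xe'; apply/eqP; apply: contraT => ne.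
by have /pred0P/(_ x)/= := tM _ _ eM e'M ne; rewrite xe xe'.
Qed.

Lemma set0_edges M : M \subset edges G -> set0 \notin M.
Proof.
by move=> ME; apply/negP => /(subsetP ME)/card_edge; rewrite cards0.
Qed.

Lemma trivIset_edgeU1 M e : M \subset edges G -> trivIset M ->
  [disjoint e & cover M] -> trivIset (e |: M).
Proof.
move=> ME tM dis; case: (@trivIsetU1 _ e M) => //; last exact: set0_edges.
move=> B BM; rewrite disjoint_subset; apply/subsetP => x xe; rewrite inE.
apply/negP => xB.
by move/pred0P: dis => /(_ x)/=; rewrite xe (mem_cover BM xB).
Qed.

(** An edge with both ends uncovered could be added to [M]. Conversely, if every edge has a covered
    end, an edge of a larger matching meets an edge of [M] and equals it by disjointness. *)
Lemma maximal_matchingE M : maximal_matching M = mm [set: G] M.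
Proof.
apply/maxsetP/mmP => [[/andP[ME tM] H]|[ME tM _ H]]; split=> //.
- move=> x y _ _ xy; apply: contraT; rewrite negb_or => /andP[xM yM].
  have Mxy : [set x; y] |: M = M.
    apply: H; last exact: subsetUr.
    rewrite /matching subUset sub1set edge_adj // ME /= trivIset_edgeU1 //.
    rewrite disjoint_subset; apply/subsetP => z; rewrite !inE.
    by case/orP=> /eqP ->.
  by case/negP: xM; apply: (@mem_cover _ [set x; y]); rewrite ?set21 // -Mxy setU11.
- by rewrite /matching ME.
move=> B /andP[BE tB] MB; apply/eqP; rewrite eqEsubset MB andbT.
apply/subsetP => e eB; have /edgesP[x [y [xy E]]] := subsetP BE _ eB.
have : (x \in cover M) || (y \in cover M) by apply: H.
case/orP=> /bigcupP[e' e'M ze'].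
  by rewrite (@trivIset_eq B e e' x) // ?(subsetP MB) // E set21.
by rewrite (@trivIset_eq B e e' y) // ?(subsetP MB) // E set22.
Qed.

(** Edges meeting $\{v,u\}$ are blocked by this edge, so maximality only constrains what remains
    after deleting both ends. The condition that the edge is not in [M] makes adding it a
    bijection. *)
Lemma mm_edge S v u M : v \in S -> u \in S -> adj v u ->
  mm S ([set v; u] |: M) && ([set v; u] \notin M) = mm (S :\: [set v; u]) M.
Proof.
move=> vS uS vu; set e := [set v; u].
have eS : e \subset S by rewrite subUset !sub1set vS.
have eE : e \in edges G by exact: edge_adj.
have covU : cover (e |: M) = e :|: cover M by rewrite /cover bigcup_setU big_set1.
apply/andP/idP => [[/mmP[ME tM cM H] eM]|/mmP[ME tM cM H]].
  have MME : M \subset e |: M by apply: subsetUr.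
  have disj x : x \in e -> x \notin cover M.
    move=> xe; apply/negP => /bigcupP[e' e'M xe']; case/negP: eM.
    by rewrite (trivIset_eq tM _ _ xe xe') ?setU11 // (subsetP MME).
  apply/mmP; split.
  - exact: subset_trans ME.
  - exact: trivIsetS tM.
  - apply/subsetP => x xM; rewrite inE; apply/andP; split.
      by apply: contraL xM; apply: disj.
    by apply: (subsetP cM); rewrite covU inE xM orbT.
  - move=> x y /setDP[xS xe] /setDP[yS ye] xy.
    by have := H x y xS yS xy; rewrite covU !(in_setU _ e) (negPf xe) (negPf ye).
have eM : e \notin M.
  apply/negP => eM; have : v \in cover M by apply: mem_cover eM (set21 _ _).
  by move/(subsetP cM); rewrite !inE eqxx.
split=> //; apply/mmP; split.
- by rewrite subUset sub1set eE.
- apply: trivIset_edgeU1 => //; rewrite disjoint_sym disjoint_subset.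
  by apply/subsetP => x /(subsetP cM)/setDP[].
- by rewrite covU subUset eS (subset_trans cM) // subsetDl.
move=> x y xS yS xy; rewrite covU !(in_setU _ e).
case xe: (x \in e) => //=; case ye: (y \in e); first by rewrite orbT.
by apply: H => //; apply/setDP; split=> //; rewrite ?xe ?ye.
Qed.

(** Maximality in [S] and in [S :\ v] differ only by the edges at [v]; with [v] uncovered, these
    force every neighbour to be covered. *)
Lemma mm_avoid S v M : v \in S ->
  mm S M && (v \notin cover M)
  = mm (S :\ v) M && [forall u in S, adj v u ==> (u \in cover M)].
Proof.
move=> vS; apply/andP/andP => [[/mmP[ME tM cM H] vM]|[/mmP[ME tM cM H] Hv]].
  split; last first.
    apply/forall_inP => u uS; apply/implyP => vu.
    by have := H v u vS uS vu; rewrite (negPf vM).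
  apply/mmP; split=> //.
    by apply/subsetP => x xM; rewrite !inE (subsetP cM) // andbT; apply: contraNneq vM => <-.
  by move=> x y /setD1P[_ xS] /setD1P[_ yS]; apply: H.
have Hv' u : u \in S -> adj v u -> u \in cover M.
  by move=> uS; move/forall_inP: Hv => /(_ u uS)/implyP.
split; last by apply/negP => /(subsetP cM); rewrite !inE eqxx.
apply/mmP; split=> //; first exact: subset_trans cM (subsetDl _ _).
move=> x y xS yS xy; have [xv|xv] := eqVneq x v.
  by rewrite xv in xy; rewrite (Hv' y) ?orbT.
have [yv|yv] := eqVneq y v.
  by rewrite yv adj_sym in xy; rewrite (Hv' x).
by apply: H => //; apply/setD1P.
Qed.

(** * The generating polynomial of maximal matchings *)

Local Open Scope ring_scope.

(** The coefficient ring stays open: integers serve for degrees and counts, reals for the limit. *)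
Definition mmpoly S : {poly R} := \sum_(M | mm S M) 'X^#|M|.

Lemma mmpoly_vertex S v : v \in S ->
  mmpoly S = \sum_(u in [set u in S | adj v u]) 'X * mmpoly (S :\: [set v; u])
           + \sum_(M | mm S M && (v \notin cover M)) 'X^#|M|.
Proof.
move=> vS; rewrite /mmpoly (bigID (fun M => v \in cover M)) /=; congr (_ + _).
(* A matching covering [v] contains exactly one edge at [v], so it is counted for exactly one
   neighbour [u]. *)
transitivity (\sum_(u in [set u in S | adj v u])
    \sum_(M | mm S M && ([set v; u] \in M)) ('X^#|M| : {poly R})).
  rewrite (exchange_big_dep (fun M => mm S M && (v \in cover M))) /=; last first.
    by move=> u M _ /andP[-> eM] /=; apply: mem_cover eM (set21 _ _).
  apply: eq_bigr => M /andP[mmM /bigcupP[e eM ve]].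
  have /mmP[ME tM cM _] := mmM.
  have [u vu E] := edge_at (subsetP ME _ eM) ve.
  rewrite (big_pred1 u) // => u' /=; rewrite mmM /=; apply/andP/eqP => [[_ eM']|->].
    have := trivIset_eq tM eM eM' ve (set21 _ _); rewrite E => E'.
    have : u' \in [set v; u] by rewrite E' set22.
    have := edge_set2 (subsetP ME _ eM') => /adj_neq.
    by rewrite !inE eq_sym => /negPf -> /= /eqP.
  split; last by rewrite -E.
  by rewrite inE vu andbT (subsetP cM) // (mem_cover eM) // E set22.
apply: eq_bigr => u; rewrite inE => /andP[uS vu].
set e := [set v; u].
(* Removing the edge $\{v,u\}$ from [M] accounts for the factor ['X]. *)
rewrite big_distrr /= (reindex_onto (fun M => e |: M) (fun M => M :\ e)) /=; last first.
  by move=> M /andP[_ eM]; rewrite setD1K.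
apply: eq_big => M.
  rewrite setU11 andbT -mm_edge //; congr (_ && _).
  by apply/eqP/idP => [<-|/setU1K //]; rewrite setD11.
move=> /andP[_ /eqP E]; rewrite cardsU1.
have -> : e \notin M by rewrite -E setD11.
by rewrite -exprS.
Qed.

Lemma mmpoly0 : mmpoly set0 = 1.
Proof.
rewrite /mmpoly (big_pred1 set0) ?cards0 // => M /=.
apply/mmP/eqP => [[ME _ cM _]|->].
  apply/setP => e; rewrite inE; apply/negP => eM.
  have /edgesP[x [y [_ E]]] := subsetP ME _ eM.
  have : x \in cover M by apply: mem_cover eM _; rewrite E set21.
  by move/(subsetP cM); rewrite inE.
split; rewrite ?sub0set //.
- by apply/trivIsetP => A B; rewrite inE.
- by rewrite /cover big_set0.
- by move=> x y; rewrite inE.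
Qed.

(** * Splitting off isolated cliques *)

Definition clique_component S C :=
  [/\ C \subset S, {in C &, forall x y, x != y -> adj x y}
    & {in C & S, forall x y, adj x y -> y \in C}].

(** No edge of the induced subgraph leaves [C], so the covered vertices of [C] are a disjoint union
    of edges of [M]. *)
Lemma clique_component_covered_even S C M : clique_component S C ->
  M \subset edges G -> trivIset M -> cover M \subset S ->
  ~~ odd #|C :&: cover M|.
Proof.
case=> CS _ Ccl ME tM cM.
have -> : C :&: cover M = cover [set e in M | e \subset C].
  apply/setP => x; rewrite inE; apply/andP/bigcupP => [[xC /bigcupP[e eM xe]]|].
    exists e => //; rewrite inE eM /=; apply/subsetP => y ye.
    have [u xu E] := edge_at (subsetP ME _ eM) xe.
    move: ye; rewrite E !inE => /orP[]/eqP -> //; apply: (Ccl x) => //.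
    by apply: (subsetP cM); apply: mem_cover eM _; rewrite E set22.
  case=> e; rewrite inE => /andP[eM eC] xe.
  by rewrite (subsetP eC) // (mem_cover eM).
have sM : [set e in M | e \subset C] \subset M.
  by apply/subsetP => e; rewrite inE => /andP[].
have /eqP <- := trivIsetS sM tM.
rewrite (eq_bigr (fun _ => 2)%N); last first.
  by move=> e; rewrite inE => /andP[eM _]; apply/card_edge/(subsetP ME).
by rewrite sum_nat_const oddM andbF.
Qed.

Lemma clique_componentD S C A :
  clique_component S C -> clique_component (S :\: A) (C :\: A).
Proof.
case=> CS Ccq Ccl; split.
- exact: setSD.
- by move=> x y /setDP[xC _] /setDP[yC _]; apply: Ccq.
- move=> x y /setDP[xC _] /setDP[yS yA] xy.
  by apply/setDP; split=> //; apply: Ccl xC yS xy.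
Qed.

Lemma setDDsub S C A : A \subset C -> (S :\: A) :\: (C :\: A) = S :\: C.
Proof.
move=> AC; apply/setP => x; rewrite !inE.
by case xA: (x \in A) => //=; rewrite (subsetP AC).
Qed.

(** If [v] is uncovered, maximality covers all of [C :\ v], which is then even. Conversely, for odd
    [#|C|] a maximal matching of [S :\ v] covers [C :\ v]: an uncovered [u] would force all others
    to be covered, an odd number. *)
Lemma clique_uncovered S C v : clique_component S C -> v \in C ->
  \sum_(M | mm S M && (v \notin cover M)) 'X^#|M|
  = (if odd #|C| then mmpoly (S :\ v) else 0) :> {poly R}.
Proof.
move=> CC vC; have [CS Ccq Ccl] := CC; have vS := subsetP CS _ vC.
have cardC : #|C| = (#|C :\ v|).+1 by rewrite (cardsD1 v C) vC.
rewrite cardC /=; case: ifPn => oC; last first.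
  rewrite negbK in oC; rewrite big_pred0 // => M; apply/negP.
  move=> /andP[/mmP[ME tM cM H] vM].
  have := clique_component_covered_even CC ME tM cM.
  suff -> : C :&: cover M = C :\ v by rewrite oC.
  apply/setP => x; rewrite !inE; have [->|xv] := eqVneq x v.
    by rewrite (negPf vM) andbF.
  case xC: (x \in C) => //=.
  have := H v x vS (subsetP CS _ xC) (Ccq _ _ vC xC _).
  by rewrite eq_sym => /(_ xv); rewrite (negPf vM).
apply: eq_bigl => M; rewrite mm_avoid //.
apply/andP/idP => [[//]|mmM]; split=> //.
have /mmP[ME tM cM H] := mmM.
apply/forall_inP => u uS; apply/implyP => vu; apply: contraT => uM.
have uC : u \in C := Ccl _ _ vC uS vu.
have uv : u != v by rewrite eq_sym adj_neq.
have := clique_component_covered_even (clique_componentD [set v] CC) ME tM cM.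
suff -> : (C :\ v) :&: cover M = (C :\ v) :\ u.
  by move: oC; rewrite (cardsD1 u (C :\ v)) !inE uv uC /= => /negPn ->.
apply/setP => x; rewrite !inE; have [->|xu] := eqVneq x u.
  by rewrite (negPf uM) andbF.
have [//|xv] := eqVneq x v; case xC: (x \in C) => //=.
have := H u x; rewrite !inE uv uS xv (subsetP CS) // (negPf uM) /=.
by apply=> //; apply: Ccq => //; rewrite eq_sym.
Qed.

(** Strong induction from the empty clique: expanding a vertex of [C] leaves smaller clique
    components, and the coefficients follow [card_mmKSS]. *)
Lemma mmpoly_clique S C : clique_component S C ->
  mmpoly S = (card_mmK #|C|)%:R * 'X^(#|C|./2) * mmpoly (S :\: C).
Proof.
move: {2}#|C| (erefl #|C|) => m; elim/ltn_ind: m S C => -[|m] IH S C cC CC.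
  by rewrite (cards0_eq cC) setD0 cards0 card_mmK0 !mul1r.
have /card_gt0P[v vC] : (0 < #|C|)%N by rewrite cC.
have [CS Ccq Ccl] := CC; have vS := subsetP CS _ vC.
have cCv : #|C :\ v| = m by move: cC; rewrite (cardsD1 v C) vC => -[].
have EN : [set u in S | adj v u] = C :\ v.
  apply/setP => u; rewrite !inE; apply/andP/andP => [[uS vu]|[uv uC]].
    by split; [rewrite eq_sym adj_neq | apply: Ccl vu].
  by split; [apply: (subsetP CS) | apply: Ccq => //; rewrite eq_sym].
have Hv : mmpoly (S :\ v) = (card_mmK m)%:R * 'X^(m./2) * mmpoly (S :\: C).
  rewrite (IH m _ _ (C :\ v)) // ?cCv; last exact: clique_componentD.
  by rewrite setDDsub // sub1set.
rewrite (mmpoly_vertex vS) EN (clique_uncovered CC vC) cC.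
case: m cC IH cCv Hv => [|m] cC IH cCv Hv.
  by rewrite (cards0_eq cCv) big_set0 add0r Hv card_mmK0 card_mmK1.
rewrite (eq_bigr (fun _ => 'X * ((card_mmK m)%:R * 'X^(m./2) * mmpoly (S :\: C)))).
  rewrite sumr_const cCv card_mmKSS Hv /= negbK -mulr_natl.
  case: (boolP (odd m)) => om /=; rewrite ?mul1n ?mul0n natrD natrM.
    (* For odd [m] the uncovered term has the same exponent as the others, because [m.+1./2] is
       [m./2 + 1]. *)
    by rewrite uphalf_half om add1n exprS; ring.
  by rewrite exprS; ring.
move=> u; rewrite !inE => /andP[uv uC]; congr (_ * _).
have cC' : #|C :\: [set v; u]| = m.
  by move: cCv; rewrite (cardsD1 u) !inE uv uC /= setDDl => -[].
rewrite (IH m _ _ (C :\: [set v; u])) ?cC' //; last exact: clique_componentD.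
by rewrite setDDsub // subUset !sub1set vC.
Qed.

Lemma mmpoly_isolated S v : v \in S -> {in S, forall u, ~~ adj v u} ->
  mmpoly S = mmpoly (S :\ v).
Proof.
move=> vS iso; rewrite (@mmpoly_clique S [set v]).
  by rewrite cards1 card_mmK1 !mul1r.
split; rewrite ?sub1set //.
  by move=> x y /set1P-> /set1P->; rewrite eqxx.
by move=> x y /set1P-> yS; rewrite (negPf (iso _ yS)).
Qed.

End MaximalMatchings.

(** * Complete graphs and evaluation at 1 *)

Local Open Scope ring_scope.

Lemma mmpoly_complete (R : comNzRingType) m :
  mmpoly R [set: complete_graph m] = (card_mmK m)%:R * 'X^(m./2).
Proof.
rewrite (@mmpoly_clique _ _ _ [set: complete_graph m]); last first.
  by split=> [|x y _ _|x y _ _ _]; rewrite ?subxx ?inE.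
by rewrite cardsT card_ord setDv mmpoly0 mulr1.
Qed.

Lemma mmpoly_T0 (R : comNzRingType) (G : sgraph) :
  (mmpoly R [set: G]).[1] = (T0 G)%:R.
Proof.
rewrite /mmpoly horner_sum /T0 cardsE -sum1_card natr_sum.
apply: eq_big => [M|M _]; first by rewrite -maximal_matchingE.
by rewrite hornerXn expr1n.
Qed.

Lemma mmpoly_T1 (R : comNzRingType) (G : sgraph) :
  (mmpoly R [set: G])^`().[1] = (T1 G)%:R.
Proof.
rewrite /mmpoly (raddf_sum (@deriv R)) horner_sum /T1 natr_sum.
apply: eq_big => [M|M _]; first by rewrite maximal_matchingE.
by rewrite /= derivXn hornerMn hornerXn expr1n.
Qed.

Lemma f_card_mmK m : f m = card_mmK m.
Proof.
have := mmpoly_T0 int (complete_graph m).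
rewrite mmpoly_complete -polyC_natr hornerCM hornerXn expr1n mulr1.
by move=> /eqP; rewrite !pmulrn eqr_int => /eqP [].
Qed.

(** * The recurrence for the graphs $G_n^{4,s}$ *)

Section G4Recurrence.
Variables (R : comNzRingType) (s n : nat) (c : 'I_n -> 'I_s).
Notation G := (G4 c).
Implicit Types (S : {set G}) (p q : G) (i j : 'I_n) (k : nat).

Definition copy_index p : 'I_n :=
  match p with inl (i, _) => i | inr i => i end.
(** The vertex $v_i$; [pendant i] below is $w_i$, and [inner i] is the $i$-th clique without
    $v_i$. *)
Definition hub i : G := inl (i, c i).
Definition pendant i : G := inr i.
Definition copy i : {set G} := [set p | copy_index p == i].
Definition inner i : {set G} := copy i :\: [set hub i; pendant i].
(** Smaller instances are taken as induced subgraphs of one fixed graph, which avoids graph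
    isomorphisms. *)
Definition first_copies k : {set G} := [set p | (copy_index p < k)%N].

Lemma hubE i j (x : 'I_s) :
  (inl (j, x) == hub i :> G) = (j == i) && (x == c i).
Proof. by []. Qed.

Lemma inner_adj i p q : p \in inner i -> adj p q ->
  (q \in inner i) || (q == hub i).
Proof.
case: p => [[j x]|j]; rewrite !inE ?hubE /=; last first.
  by move=> /andP[/negP ji /eqP E]; case: ji; rewrite E.
rewrite orbF => /andP[+ /eqP ji]; rewrite ji eqxx /= => xc.
case: q => [[l y]|l]; rewrite ?hubE /= (negPf xc) ?andbF // orbF.
by move=> /andP[/eqP <- _]; rewrite eqxx /= orbF andbT orNb.
Qed.

Lemma inner_clique i : {in inner i &, forall p q, p != q -> adj p q}.
Proof.
move=> [[j x]|j] [[l y]|l]; rewrite !inE ?hubE /=.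
- move=> /andP[_ /eqP ->] /andP[_ /eqP ->] ne; rewrite eqxx /=.
  by apply/orP; left; apply: contraNneq ne => ->.
- by move=> _ /andP[/negP + /eqP E]; rewrite E; case; rewrite eqxx.
- by move=> /andP[/negP + /eqP E]; rewrite E; case; rewrite eqxx.
- by move=> /andP[/negP + /eqP E]; rewrite E; case; rewrite eqxx.
Qed.

Lemma pendant_adj i q : adj (pendant i) q -> q = hub i.
Proof. by case: q => [[j y]|j] //= /andP[/eqP <- /eqP ->]. Qed.

Lemma hub_adj i q : adj (hub i) q ->
  [\/ q = pendant i, q \in inner i
    | exists2 j, q = hub j & (j == i.+1 :> nat) || (i == j.+1 :> nat)].
Proof.
case: q => [[j y]|j] /=; last by move=> /andP[/eqP <- _]; constructor 1.
case/orP=> [/andP[/eqP <- H]|/and3P[_ /eqP -> H]].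
  by constructor 2; rewrite !inE hubE eqxx /= andbT orbF eq_sym.
by constructor 3; exists j.
Qed.

Lemma card_inner i : #|inner i| = s.-1.
Proof.
have -> : inner i = [set (inl (i, x) : G) | x in [set~ c i]].
  apply/setP => -[[j x]|j]; rewrite !inE ?hubE /=.
    apply/andP/imsetP => [[+ /eqP ji]|[y]].
      by rewrite ji eqxx orbF /= => xc; exists x; rewrite ?inE.
    by rewrite !inE => yc [-> ->]; rewrite eqxx orbF.
  apply/idP/imsetP => [/andP[/negP + /eqP E]|[]//].
  by rewrite E; case; rewrite eqxx.
rewrite card_imset; last by move=> x y [].
by rewrite cardsC1 card_ord.
Qed.

Definition clique_poly m : {poly R} := (card_mmK m)%:R * 'X^(m./2).

(** Without its hub, the pendant is isolated and the rest of the copy is a clique component, so the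
    whole copy splits off as a factor. *)
Lemma mmpoly_copy S i : hub i \notin S ->
  mmpoly R S = clique_poly #|S :&: inner i| * mmpoly R (S :\: copy i).
Proof.
rewrite /clique_poly => hS.
have -> : mmpoly R S = mmpoly R (S :\ pendant i).
  have [pS|pS] := boolP (pendant i \in S); last first.
    by congr mmpoly; apply/setP => x; rewrite !inE; case: eqP => // ->; rewrite (negPf pS).
  by apply: mmpoly_isolated => // u uS; apply: contra hS => /pendant_adj <-.
rewrite (@mmpoly_clique _ _ _ (S :&: inner i)); last first.
  split.
  - by apply/subsetP => x; rewrite !inE negb_or => /and3P[-> /andP[_ ->]].
  - by move=> x y /setIP[_ xi] /setIP[_ yi]; apply: (inner_clique xi yi).
  - move=> x y /setIP[xS xi] /setD1P[yp yS] /(inner_adj xi)/orP[yi|/eqP yh].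
      by rewrite inE yS.
    by rewrite -yh yS in hS.
congr (_ * mmpoly _ _); apply/setP => x; rewrite !inE.
case xS: (x \in S); last by rewrite !andbF.
have -> : x == hub i = false by apply: contraNF hS => /eqP <-.
by rewrite !andbT /= andbC; case: eqP => // ->; rewrite /= eqxx.
Qed.

(** Contribution of a hub matched inside its own copy: with the pendant, leaving $K_{s-1}$, or with
    one of $s-1$ inner vertices, leaving $K_{s-2}$. In [pair_poly] two consecutive hubs are matched,
    leaving two copies of $K_{s-1}$. *)
Definition single_poly : {poly R} :=
  'X * clique_poly s.-1 + (s.-1)%:R * ('X * clique_poly s.-2).
Definition pair_poly : {poly R} := 'X * clique_poly s.-1 ^+ 2.

Lemma inner_sub_first k i : (i < k)%N -> inner i \subset first_copies k.
Proof.
by move=> ik; apply/subsetP => p; rewrite !inE => /andP[_ /eqP ->].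
Qed.

Lemma first_copiesD k (kn : (k < n)%N) :
  first_copies k.+1 :\: copy (Ordinal kn) = first_copies k.
Proof.
by apply/setP => p; rewrite !inE -val_eqE /= ltnS ltn_neqAle.
Qed.

Lemma mmpoly_remove_hub_copy k (kn : (k < n)%N) u : u \in copy (Ordinal kn) ->
  mmpoly R (first_copies k.+1 :\: [set hub (Ordinal kn); u])
  = clique_poly #|inner (Ordinal kn) :\ u| * mmpoly R (first_copies k).
Proof.
set i := Ordinal kn => ui.
rewrite (@mmpoly_copy _ i) ?inE ?eqxx //; congr (_ * _).
  congr clique_poly; apply: eq_card => p; rewrite !inE.
  case: (p == hub i); first by rewrite !andbF.
  case: (p == u) => //=; case: (p == _) => /=; first by rewrite !andbF.
  by case: eqP => [->|_]; rewrite ?andbF // /i /= ltnSn.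
congr mmpoly; rewrite -(first_copiesD kn) setDDl -/i; congr (_ :\: _).
apply/setUidPr; rewrite subUset !sub1set inE /= eqxx /=.
exact: ui.
Qed.

Lemma mmpoly_remove_hubs k (kn : (k.+1 < n)%N) (kn' : (k < n)%N) :
  mmpoly R (first_copies k.+2 :\: [set hub (Ordinal kn); hub (Ordinal kn')])
  = clique_poly s.-1 ^+ 2 * mmpoly R (first_copies k).
Proof.
set i := Ordinal kn; set j := Ordinal kn'.
have ji : j != i by rewrite -val_eqE /= ltn_eqF.
rewrite (@mmpoly_copy _ i) ?inE ?eqxx //.
rewrite (@mmpoly_copy (_ :\: copy i) j) ?inE ?eqxx ?orbT ?andbF //.
have -> : (first_copies k.+2 :\: [set hub i; hub j]) :&: inner i = inner i.
  apply/setIidPr/subsetP => p pi; rewrite inE (subsetP (@inner_sub_first _ i _)) //.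
  rewrite andbT; move: pi; rewrite !inE => /andP[/norP[/negPf -> _] pi].
  apply: contraNneq ji => E; rewrite E in pi; exact: pi.
have -> : (first_copies k.+2 :\: [set hub i; hub j] :\: copy i) :&: inner j
   = inner j.
  apply/setIidPr/subsetP => p pj; rewrite !inE.
  move: pj; rewrite !inE => /andP[/norP[/negPf -> _] /eqP pj].
  rewrite pj ji orbF /= ltnS leqnSn andbT.
  by apply: contraNneq ji => E; rewrite -pj E.
rewrite !card_inner mulrA -expr2; congr (_ * mmpoly _ _).
apply/setP => p; rewrite !inE.
have := val_eqE (copy_index p) i; have := val_eqE (copy_index p) j.
case: (eqVneq p (hub i)) => [->|_] /=; first by rewrite eqxx andbF => _ _; lia.
case: (eqVneq p (hub j)) => [->|_] /=; first by rewrite eqxx => _ _; lia.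
by move=> <- <- /=; lia.
Qed.

(** The edge $v_iw_i$ needs a covered end, and it is the only edge at $w_i$. *)
Lemma hub_covered i S M : hub i \in S -> pendant i \in S -> mm S M ->
  hub i \in cover M.
Proof.
move=> hS pS /mmP[ME tM cM H].
have /orP[//|/bigcupP[e eM pe]] : (hub i \in cover M) || (pendant i \in cover M).
  by apply: H => //=; rewrite !eqxx.
have [u /pendant_adj -> E] := edge_at (subsetP ME _ eM) pe.
by apply: mem_cover eM _; rewrite E set22.
Qed.

(** Expansion at the last hub, which is always covered. The sum over partners in other copies is
    left open: it is empty for the first copy and a single term afterwards. *)
Lemma mmpoly_first_copiesS k (kn : (k < n)%N) :
  mmpoly R (first_copies k.+1) = single_poly * mmpoly R (first_copies k)
  + \sum_(u in [set u in first_copies k.+1 |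
               adj (hub (Ordinal kn)) u && (u \notin copy (Ordinal kn))])
      'X * mmpoly R (first_copies k.+1 :\: [set hub (Ordinal kn); u]).
Proof.
set i := Ordinal kn.
have hS : hub i \in first_copies k.+1 by rewrite inE /= ltnSn.
have pS : pendant i \in first_copies k.+1 by rewrite inE /= ltnSn.
rewrite (mmpoly_vertex _ hS) [X in _ + X]big_pred0 ?addr0; last first.
  by move=> M; apply/negP => /andP[/(hub_covered hS pS) ->].
rewrite (big_setID (copy i)); congr (_ + _); last first.
  by apply: eq_bigl => u; rewrite !inE andbC -andbA.
have -> : [set u in first_copies k.+1 | adj (hub i) u] :&: copy i
          = pendant i |: inner i.
  apply/setP => u; rewrite in_setU1 !in_setI; apply/idP/idP.
    case/andP; rewrite inE => /andP[_] /hub_adj[->|->|[j -> ji]]; rewrite ?eqxx ?orbT //.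
    by rewrite inE /= => /eqP E; rewrite E orbb ltn_eqF in ji.
  case/orP=> [/eqP ->|ui]; first by rewrite inE pS inE /= !eqxx.
  rewrite inE (subsetP (inner_sub_first _) _ ui) //=; move: (ui).
  rewrite in_setD => /andP[_ ->]; rewrite andbT.
  case: u ui => [[j x]|j]; rewrite !inE ?hubE /=.
    by move=> /andP[+ /eqP E]; rewrite E orbF !eqxx /= eq_sym /Kadj => ->.
  by move=> /andP[/negP + /eqP E]; rewrite E; case; rewrite eqxx.
have pi : pendant i \notin inner i by rewrite !inE eqxx orbT.
rewrite big_setU1 //= mulrDl; congr (_ + _).
  rewrite mmpoly_remove_hub_copy ?inE // -/i.
  have -> : inner i :\ pendant i = inner i by apply/setDidPl; rewrite disjoint_sym disjoints1.
  by rewrite card_inner mulrA.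
rewrite (eq_bigr (fun _ => 'X * clique_poly s.-2 * mmpoly R (first_copies k))).
  by rewrite sumr_const card_inner -[LHS]mulr_natl mulrA.
move=> u ui; rewrite mmpoly_remove_hub_copy -/i.
  have -> : #|inner i :\ u| = s.-2 by rewrite -(card_inner i) (cardsD1 u (inner i)) ui.
  by rewrite mulrA.
by move: ui; rewrite inE => /andP[].
Qed.

Lemma first_copies0 : first_copies 0 = set0.
Proof. by apply/setP => p; rewrite !inE. Qed.

Lemma mmpoly_first_copies1 (n0 : (0 < n)%N) :
  mmpoly R (first_copies 1) = single_poly.
Proof.
rewrite mmpoly_first_copiesS first_copies0 mmpoly0 mulr1 big1 ?addr0 // => u.
rewrite inE in_set => /and3P[u0 _ /negP ui]; case: ui.
by rewrite inE -val_eqE /=; move: u0; rewrite ltnS leqn0.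
Qed.

Lemma mmpoly_first_copiesSS k : (k.+1 < n)%N ->
  mmpoly R (first_copies k.+2)
  = single_poly * mmpoly R (first_copies k.+1)
    + pair_poly * mmpoly R (first_copies k).
Proof.
move=> kn; rewrite mmpoly_first_copiesS; congr (_ + _).
have kn' : (k < n)%N by exact: ltnW.
set i := Ordinal kn; pose j := Ordinal kn'.
have ji : j != i by rewrite -val_eqE /= ltn_eqF.
rewrite (_ : [set u in _ | _] = [set hub j]); last first.
  apply/setP => u; rewrite in_set1; apply/idP/eqP => [|->].
    rewrite inE in_set => /and3P[uk /hub_adj[->|ui|[l ul li]]].
    - by rewrite inE eqxx.
    - by move: ui; rewrite in_setD => /andP[_ ->].
    - rewrite inE ul => ne; congr hub; apply: val_inj => /=.
      (* The next hub lies outside [first_copies k.+2], so only the previous one remains. *)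
      move: uk ne li; rewrite ul -val_eqE /=; lia.
  rewrite in_set; apply/and3P; split.
  - by rewrite inE /= ltnS leqnSn.
  - by rewrite /= !eqxx !orbT.
  - by rewrite inE.
by rewrite big_set1 mmpoly_remove_hubs mulrA.
Qed.

End G4Recurrence.

(** * Second-order linear recurrences *)

Section LinearRecurrence.
Variable T : pzRingType.

(** Stated over a general ring, to serve both for polynomials and for their values. *)
Fixpoint linrec (A B : T) (n : nat) : T :=
  match n with
  | 0 => 1
  | m.+1 => match m with
            | 0 => A
            | k.+1 => A * linrec A B m + B * linrec A B k
            end
  end.

Lemma linrecSS A B n :
  linrec A B n.+2 = A * linrec A B n.+1 + B * linrec A B n.
Proof. by []. Qed.

End LinearRecurrence.

Lemma nat_ind2 (P : nat -> Prop) :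
  P 0%N -> P 1%N -> (forall n, P n -> P n.+1 -> P n.+2) -> forall n, P n.
Proof.
move=> P0 P1 PSS n; suff : P n /\ P n.+1 by case.
by elim: n => [|n [Pn PSn]]; split=> //; apply: PSS.
Qed.

Lemma mmpoly_G4 (R : comNzRingType) s n (c : 'I_n -> 'I_s) :
  mmpoly R [set: G4 c] = linrec (single_poly R s) (pair_poly R s) n.
Proof.
suff H k : (k <= n)%N ->
    mmpoly R (first_copies c k) = linrec (single_poly R s) (pair_poly R s) k.
  by rewrite -H //; congr mmpoly; apply/setP => p; rewrite !inE ltn_ord.
elim/nat_ind2: k => [|n0|k IH0 IH1 kn]; first by rewrite first_copies0 mmpoly0.
  exact: mmpoly_first_copies1.
by rewrite mmpoly_first_copiesSS // IH1 ?IH0 //; lia.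
Qed.

(** * Degree and matching number *)

Lemma coef_mmpoly (R : comNzRingType) (G : sgraph) (S : {set G}) k :
  (mmpoly R S)`_k = #|[set M | mm S M && (#|M| == k)]|%:R.
Proof.
rewrite /mmpoly coef_sum cardsE -sum1_card natr_sum.
rewrite [RHS]big_mkcondr; apply: eq_bigr => M _.
by rewrite coefXn eq_sym; case: eqP.
Qed.

Lemma mm_size_mmpoly (G : sgraph) (S : {set G}) M :
  mm S M -> (#|M| < size (mmpoly int S))%N.
Proof.
move=> mmM; rewrite ltnNge; apply/negP => /leq_sizeP/(_ _ (leqnn _))/eqP.
rewrite coef_mmpoly pnatr_eq0 cards_eq0 => /eqP/setP/(_ M).
by rewrite !inE mmM eqxx.
Qed.

(** Every matching extends to a maximal one, so the largest size of a maximal matching is [nu].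
    Integer coefficients are counts, hence nonzero wherever a maximal matching has that size. *)
Lemma nu_mmpoly (G : sgraph) : nu G = (size (mmpoly int [set: G])).-1.
Proof.
apply/eqP; rewrite eqn_leq; apply/andP; split.
  apply/bigmax_leqP => M mM.
  have [M' maxM' MM'] := maxset_exists mM.
  have := maxM'; rewrite -/(maximal_matching M') maximal_matchingE.
  by move=> /mm_size_mmpoly; have := subset_leq_card MM'; lia.
have [->//|P0] := eqVneq (mmpoly int [set: G]) 0; first by rewrite size_poly0.
have := P0; rewrite -lead_coef_eq0 lead_coefE coef_mmpoly pnatr_eq0 cards_eq0.
case/set0Pn=> M; rewrite inE => /andP[mmM /eqP <-].
apply: leq_bigmax_cond.
by move: mmM; rewrite -maximal_matchingE => /maxsetp.
Qed.

Lemma coefM_top (R : comNzRingType) (P Q : {poly R}) d e :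
  (size P <= d.+1)%N -> (size Q <= e.+1)%N -> (P * Q)`_(d + e) = P`_d * Q`_e.
Proof.
move=> sP sQ; have dd : (d < (d + e).+1)%N by rewrite ltnS leq_addr.
rewrite coefM (bigD1 (Ordinal dd)) //= addKn big1 ?addr0 // => j jd.
have [dj|jd'] := ltnP d j.
  by rewrite nth_default ?mul0r // (leq_trans sP).
rewrite [X in _ * X]nth_default ?mulr0 // (leq_trans sQ) //.
by move: jd; rewrite -val_eqE /=; lia.
Qed.

(** Degree exactly [d] with positive leading coefficient; the sign excludes cancellation in sums. *)
Definition has_top (R : realDomainType) (P : {poly R}) d :=
  (size P <= d.+1)%N /\ 0 < P`_d.

Lemma has_top_linrec (R : realDomainType) (A B : {poly R}) p n :
  has_top A p -> (size B <= (2 * p).+1)%N -> 0 <= B`_(2 * p) ->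
  has_top (linrec A B n) (n * p).
Proof.
move=> [sA A0] sB B0; elim/nat_ind2: n => [||n [sn Pn] [sSn PSn]].
- by split; rewrite ?size_poly1 // mul0n coef1.
- by rewrite mul1n.
rewrite linrecSS; split.
  apply: leq_trans (size_polyD _ _) _; rewrite geq_max; apply/andP; split.
    by apply: leq_trans (size_polyMleq _ _) _; move: sA sSn; rewrite /=; lia.
  by apply: leq_trans (size_polyMleq _ _) _; move: sB sn; lia.
(* The top exponent is read as [p + n.+1 * p] in the first product and as [2 * p + n * p] in the
   second. *)
rewrite coefD mulSn coefM_top // mulSn addnA addnn -mul2n coefM_top //.
by rewrite ltr_pwDl ?mulr_gt0 // mulr_ge0 // ltW.
Qed.

Section StepPolynomials.
Variables (R : realDomainType) (s : nat).
Hypothesis s_gt0 : (0 < s)%N.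

Lemma single_polyE : single_poly R s =
  (f (s - 1))%:R *: 'X^((s + 1)./2)
  + ((s - 1) * f (s - 2))%:R *: 'X^(uphalf (s - 1)).
Proof.
rewrite /single_poly /clique_poly !f_card_mmK -!mul_polyC !polyC_natr natrM.
(* For [s = 1] the exponents of the second terms differ, but both coefficients vanish. *)
case: s s_gt0 => // -[|t] _; first by rewrite /= !mul0r !addr0; ring.
by rewrite !subSS !subn0 /= addn1 /= !exprS; ring.
Qed.

Lemma pair_polyE : pair_poly R s =
  ((f (s - 1))%:R ^+ 2) *: 'X^(2 * (s - 1)./2 + 1).
Proof.
rewrite /pair_poly /clique_poly f_card_mmK -mul_polyC polyC_exp polyC_natr.
by rewrite subn1 mulnC exprD exprM; ring.
Qed.

End StepPolynomials.

(** [single_poly] has degree [uphalf s], and the exponent $2\lfloor (s-1)/2\rfloor+1$ of [pair_poly]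
    is at most twice that, so each copy adds [uphalf s] to the degree. *)
Lemma nu_G4 s n (c : 'I_n -> 'I_s) : (0 < s)%N -> nu (G4 c) = (n * uphalf s)%N.
Proof.
move=> s0; rewrite nu_mmpoly mmpoly_G4.
set A := single_poly _ _; set B := pair_poly _ _.
have f0 m : 0 < (f m)%:R :> int by rewrite ltr0n f_card_mmK card_mmK_gt0.
have Es : (s + 1)./2 = uphalf s by rewrite addn1.
have [] : has_top (linrec A B n) (n * uphalf s).
  apply: has_top_linrec.
  - rewrite /A single_polyE // Es; split.
      apply: leq_trans (size_polyD _ _) _; rewrite geq_max; apply/andP; split.
        by apply: leq_trans (size_scale_leq _ _) _; rewrite size_polyXn.
      apply: leq_trans (size_scale_leq _ _) _; rewrite size_polyXn ltnS.
      by rewrite !uphalfE half_leq //; lia.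
    rewrite coefD !coefZ !coefXn eqxx mulr1 ltr_pwDl // mulr_ge0 ?ler0n //.
  - rewrite /B pair_polyE.
    apply: leq_trans (size_scale_leq _ _) _; rewrite size_polyXn; lia.
  - by rewrite /B pair_polyE coefZ coefXn mulr_ge0 ?ler0n // exprn_ge0 ?ler0n.
set P := linrec _ _ _ => sP Ptop; apply/eqP; rewrite eqn_leq.
have : (n * uphalf s < size P)%N.
  by rewrite ltnNge; apply/negP => /leq_sizeP/(_ _ (leqnn _)) E; rewrite E ltxx in Ptop.
by move: sP; case: (size P) => //= d; lia.
Qed.

(** * Closed forms at the characteristic roots *)

Lemma horner_linrec (R : comNzRingType) (A B : {poly R}) x n :
  (linrec A B n).[x] = linrec A.[x] B.[x] n.
Proof.
elim/nat_ind2: n => [||n IH0 IH1]; rewrite ?hornerC // !linrecSS hornerD !hornerM.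
by rewrite IH0 IH1.
Qed.

Section ClosedForm.
Variables (R : fieldType) (r q : R).
Hypotheses (r_neq0 : r != 0) (rq : r - q != 0).

(** Binet's formula: both sides satisfy the recurrence with roots [r] and [q] and agree for [n = 0]
    and [n = 1]. *)
Lemma linrec_roots n :
  linrec (r + q) (- (r * q)) n = (r ^+ n.+1 - q ^+ n.+1) / (r - q).
Proof.
elim/nat_ind2: n => [||n IH0 IH1].
- by rewrite !expr1 divff.
- by rewrite /= !expr2; field.
by rewrite linrecSS IH0 IH1 !exprS; field.
Qed.

(* [r] and [q] are the roots of [x ^+ 2 = A.[1] * x + B.[1]], and the slope [L]
   is the logarithmic derivative at 1 of the larger one as a function of the
   evaluation point. *)
Lemma deriv_linrec_roots (A B : {poly R}) n :
  A.[1] = r + q -> B.[1] = - (r * q) ->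
  let L := (r * A^`().[1] + B^`().[1]) / (r * (r - q)) in
  let al := A^`().[1] - L * (r + q) in
  let de := - al / (r - q) in
  let be := (al - de * q) / (r - q) in
  (linrec A B n)^`().[1]
  = n%:R * L * linrec (r + q) (- (r * q)) n + be * (r ^+ n - q ^+ n)
    + de * n%:R * q ^+ n.
Proof.
move=> A1 B1 L al de be; rewrite linrec_roots.
elim/nat_ind2: n => [||n IH0 IH1].
- by rewrite /= derivC horner0 !expr0 subrr; ring.
(* The case [n = 1] is what determines [be]. *)
- by rewrite /= /be /de /al !expr1; field; rewrite ?r_neq0 ?rq.
rewrite linrecSS derivD !derivM !hornerD !hornerM IH0 IH1 !horner_linrec A1 B1.
rewrite !linrec_roots.
(* Solving the definition of [L] for the derivative of [B] allows [L] to be treated as a free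
   variable in the final identity. *)
have EB : B^`().[1] = L * r * (r - q) - r * A^`().[1].
  by rewrite /L; field; rewrite ?r_neq0 ?rq.
rewrite EB /be /de /al; move: L {be de al EB IH0 IH1} => L.
rewrite !exprS; field; exact: rq.
Qed.

End ClosedForm.

(* Passage to the limit *)
From mathcomp Require Import all_classical all_reals all_analysis.
Import numFieldNormedType.Exports.
Local Open Scope classical_set_scope.
Local Open Scope ring_scope.

Section Limit.
Variables (R : realType) (A B : {poly R}).
Hypotheses (A_gt0 : 0 < A.[1]) (B_gt0 : 0 < B.[1]).

(** The larger root of $x^2=A(1)x+B(1)$; [q] is the other one, by the sum of the roots. $B(1)>0$
    gives $q<0$, and then $A(1)>0$ gives $|q|=r-A(1)<r$. *)
Let r : R := (A.[1] + Num.sqrt (A.[1] ^+ 2 + 4 * B.[1])) / 2.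
Let q : R := A.[1] - r.

Let disc_ge0 : 0 <= A.[1] ^+ 2 + 4 * B.[1].
Proof. by rewrite addr_ge0 ?exprn_ge0 ?mulr_ge0 ?ltW. Qed.

Let sqrt_gt : A.[1] < Num.sqrt (A.[1] ^+ 2 + 4 * B.[1]).
Proof.
rewrite -[X in X < _](gtr0_norm A_gt0) -sqrtr_sqr ltr_sqrt.
  by rewrite ltrDl mulr_gt0.
by rewrite ltr_wpDl ?sqr_ge0 ?mulr_gt0.
Qed.

Let r_gt0 : 0 < r.
Proof. by rewrite /r divr_gt0 ?addr_gt0 //; apply: lt_trans sqrt_gt. Qed.
Let q_lt0 : q < 0. Proof. by rewrite /q /r; have := sqrt_gt; lra. Qed.
Let normq_lt : `|q| < r.
Proof. by rewrite ltr0_norm ?q_lt0 // /q; have := A_gt0; lra. Qed.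
Let AE : A.[1] = r + q. Proof. by rewrite /q; ring. Qed.
Let BE : B.[1] = - (r * q).
Proof.
have := sqr_sqrtr disc_ge0; rewrite /q /r; move: (Num.sqrt _) => x; nra.
Qed.

(** After division by $r^n$ the closed form depends on powers of $\rho=q/r$ with $|\rho|<1$; the
    [be] term vanishes like $1/n$ and the [de] term like $\rho^n$. *)
Lemma cvg_linrec_ratio :
  (linrec A B n)^`().[1] / (n%:R * (linrec A B n).[1]) @[n --> \oo] -->
  (r * A^`().[1] + B^`().[1]) / (r * A.[1] + 2 * B.[1]).
Proof.
have r0 : r != 0 by rewrite gt_eqF.
have rq : r - q != 0 by rewrite gt_eqF // subr_gt0 (lt_trans q_lt0).
have -> : r * A.[1] + 2 * B.[1] = r * (r - q) by rewrite AE BE; ring.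
set L := (X in _ --> X).
pose al := A^`().[1] - L * (r + q); pose de := - al / (r - q).
pose be := (al - de * q) / (r - q).
pose rho := q / r.
have nrho : `|rho| < 1 by rewrite normrM normfV (gtr0_norm r_gt0) ltr_pdivrMr // mul1r.
(* Here $|q\rho^n|\le|q|<r$. *)
have den0 n : r - q * rho ^+ n != 0.
  rewrite gt_eqF // subr_gt0 (le_lt_trans (ler_norm _)) // normrM.
  rewrite (le_lt_trans _ normq_lt) // ler_piMr // normrX exprn_ile1 // ltW //.
have ratioE n :
    (linrec A B n.+1)^`().[1] / (n.+1%:R * (linrec A B n.+1).[1])
    = L + be * (r - q) * n.+1%:R^-1 * (1 - rho ^+ n.+1) / (r - q * rho ^+ n.+1)
      + de * (r - q) * rho ^+ n.+1 / (r - q * rho ^+ n.+1).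
  rewrite (deriv_linrec_roots r0 rq _ AE BE) -/L -/al -/de -/be.
  rewrite horner_linrec AE BE (linrec_roots rq).
  have rn0 : r ^+ n.+1 != 0 by rewrite expf_neq0.
  have qE : q ^+ n.+1 = r ^+ n.+1 * rho ^+ n.+1.
    by rewrite /rho (expr_div_n q r) mulrCA divff ?mulr1.
  rewrite [r ^+ n.+2]exprS [q ^+ n.+2]exprS qE; have := den0 n.+1.
  move: (rho ^+ n.+1) (r ^+ n.+1) rn0 => e x x0 d0.
  field; rewrite d0 rq nat1r pnatr_eq0 /=.
  by rewrite mulrCA [r * x]mulrC -mulrBr mulf_neq0.
have rhoS : rho ^+ n.+1 @[n --> \oo] --> (0 : R).
  by rewrite (cvg_shiftS (fun n => rho ^+ n)); exact: cvg_expr.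
have h : (n.+1%:R^-1 : R) @[n --> \oo] --> (0 : R) by exact: cvg_harmonic.
have den : (r - q * rho ^+ n.+1)^-1 @[n --> \oo] --> (r - q * 0)^-1.
  apply: cvgV; first by rewrite mulr0 subr0.
  by apply: cvgB; [exact: cvg_cst | apply: cvgM => //; exact: cvg_cst].
(* The limit is put into the shape of [ratioE], so that it can be taken term by term. *)
have LE : L + be * (r - q) * 0 * (1 - 0) / (r - q * 0)
          + de * (r - q) * 0 / (r - q * 0) = L by ring.
rewrite -LE -cvg_shiftS (eq_cvg _ _ ratioE).
apply: cvgD.
  apply: cvgD; first exact: cvg_cst.
  apply: cvgM => //; apply: cvgM; last by apply: cvgB => //; exact: cvg_cst.
  by apply: cvgM => //; exact: cvg_cst.
by apply: cvgM => //; apply: cvgM => //; exact: cvg_cst.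
Qed.

End Limit.

(** * The limit of the ratio for $G_n^{4,s}$ *)

Theorem theorem7 (R : realType) (s : nat) (hs : (1 <= s)%N)
    (c : forall n : nat, 'I_n -> 'I_s) :
  [/\ f 0 = 1%N,
      forall m : nat, odd m -> f m = dfact m,
      forall m : nat, ~~ odd m -> (0 < m)%N -> f m = dfact m.-1 &
      let a : R := (f (s - 1))%:R in
      let b : R := ((s - 1) * f (s - 2))%:R in
      let r : R :=
        (a + b + Num.sqrt (5 * a ^+ 2 + 2 * b * a + b ^+ 2)) / 2 in
      (Iratio R (G4 (c n)) @[n --> \oo]) -->
        ((r * (((s + 1)./2)%:R * a + (uphalf (s - 1))%:R * b)
            + (2 * ((s - 1)./2)%:R + 1) * a ^+ 2)
         / ((uphalf s)%:R * (r * (a + b) + 2 * a ^+ 2)))].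
Proof.
split.
- by rewrite f_card_mmK card_mmK0.
- by move=> m om; rewrite f_card_mmK /card_mmK om.
- by move=> m /negPf om _; rewrite f_card_mmK /card_mmK om.
move=> a b r.
have a_gt0 : 0 < a by rewrite ltr0n f_card_mmK card_mmK_gt0.
have b_ge0 : 0 <= b by rewrite ler0n.
have A1 : (single_poly R s).[1] = a + b.
  by rewrite single_polyE // hornerD !hornerZ !hornerXn !expr1n !mulr1.
have B1 : (pair_poly R s).[1] = a ^+ 2.
  by rewrite pair_polyE hornerZ hornerXn expr1n mulr1.
have A1' : (single_poly R s)^`().[1] = ((s + 1)./2)%:R * a + (uphalf (s - 1))%:R * b.
  (* Differentiating at 1 weights each coefficient by its exponent, which yields the floors and
     ceilings of the statement. *)
  rewrite single_polyE // derivD !derivZ !derivXn hornerD !hornerZ !hornerMn.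
  by rewrite !hornerXn !expr1n -/a -/b; ring.
have B1' : (pair_poly R s)^`().[1] = (2 * ((s - 1)./2)%:R + 1) * a ^+ 2.
  rewrite pair_polyE derivZ derivXn hornerZ hornerMn hornerXn expr1n -/a.
  by rewrite natrD natrM; ring.
have := @cvg_linrec_ratio R (single_poly R s) (pair_poly R s).
rewrite A1 B1 A1' B1' (_ : (a + b) ^+ 2 + 4 * a ^+ 2
  = 5 * a ^+ 2 + 2 * b * a + b ^+ 2); last by ring.
rewrite -/r ltr_wpDr // exprn_gt0 // => /(_ isT isT) lim.
have u0 : (uphalf s)%:R != 0 :> R by rewrite pnatr_eq0; case: s hs {c a b r a_gt0 b_ge0 A1 B1 A1' B1' lim}.
rewrite (_ : _ / (_ * (_ + _)) = (uphalf s)%:R^-1 *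
  ((r * (((s + 1)./2)%:R * a + (uphalf (s - 1))%:R * b)
            + (2 * ((s - 1)./2)%:R + 1) * a ^+ 2)
         / (r * (a + b) + 2 * a ^+ 2))); last by rewrite invfM mulrCA.
(* At [n = 0] the matching number is 0 and [Iratio] takes its conventional value, so the sequence
   starts at 1. *)
rewrite -cvg_shiftS; rewrite -cvg_shiftS in lim.
have IratioE n : Iratio R (G4 (c n.+1)) = (uphalf s)%:R^-1 *
  ((linrec (single_poly R s) (pair_poly R s) n.+1)^`().[1] /
   (n.+1%:R * (linrec (single_poly R s) (pair_poly R s) n.+1).[1])).
  rewrite /Iratio nu_G4 // muln_eq0 /=.
  rewrite -(pnatr_eq0 R) (negPf u0) -mmpoly_T0 -mmpoly_T1 !mmpoly_G4.
  by rewrite natrM [_%:R * _]mulrC -mulrA invfM mulrCA.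
by rewrite (eq_cvg _ _ IratioE); apply: cvgM => //; exact: cvg_cst.
Qed.
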